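(* Let $\lambda_1^*,\lambda_2^*,\mu_1^*,\mu_2^*,\omega_1^2,\omega_2^2>0$. If $\eta_1>0$, $\eta_2>0$ and $\eta_1(\mu_2^*-\lambda_2^* )+\eta_2(\mu_1^*-\lambda_1^* )>0$, then the steady-state density of ${\bf X}=(X,\mathscr{E})$ can be expressed in terms of the roots $\xi_1^*>0$, $\xi_2^*>0$ and $\xi_3^*<0$ of the polynomial $$P^*(z)=\omega_1^2\omega_2^2z^3+2[\omega_1^2(\lambda_2^*-\mu_2^* )+\omega_2^2(\lambda_1^*-\mu_1^* )]z^2-2[\omega_1^2\eta_2-2(\lambda_1^*-\mu_1^* )(\lambda_2^*-\mu_2^* )+\omega_2^2\eta_1]z-4[\eta_1(\lambda_2^*-\mu_2^* )+\eta_2(\lambda_1^*-\mu_1^* )]$$ as follows: $$W_i(x)=\frac{\eta_{3-i}}{\eta_1+\eta_2}\Bigl[A_i^*h_1(x)+(1-A_i^* )h_2(x)\Bigr],\qquad x\in\mathbb{R}^+,\ i=1,2,$$ where $h_i(x)=\xi_i^*e^{-\xi_i^*x}$ denotes the exponential density with mean $1/\xi_i^*$ ($i=1,2$) and $$A_i^*=\frac{4\,[\eta_1(\mu_2^*-\lambda_2^* )+\eta_2(\mu_1^*-\lambda_1^* )]}{\omega_1^2\,\omega_2^2\,\xi_1^*\,\xi_3^*\,(\xi_1^*-\xi_2^* )}\cdot\frac{\omega_{3-i}^2(\xi_1^*+\xi_3^* )-2(\mu_{3-i}^*-\lambda_{3-i}^* )}{\omega_{3-i}^2\xi_3^*-2(\mu_{3-i}^*-\lambda_{3-i}^*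 )},\qquad i=1,2.$$
   Context: $\mathbb R^+=(0,\infty)$, $\mathbb R_0^+=[0,\infty)$. $\{{\bf X}(t)=[X(t),\mathscr{E}(t)],\,t\ge0\}$ is the alternating Wiener process with state space $\mathbb{R}^+_0\times\{1,2\}$: the environment $\mathscr{E}(t)$ switches from $1$ to $2$ at rate $\eta_1$ and from $2$ to $1$ at rate $\eta_2$, and while $\mathscr{E}(t)=i$ the component $X(t)$ evolves as a Wiener process with drift $\lambda_i^*-\mu_i^*$ and infinitesimal variance $\omega_i^2$, with a reflecting boundary at $0$. The initial state is $(y,1)$ with probability $p$ and $(y,2)$ with probability $1-p$ ($y\ge0$, $p\in[0,1]$). Its densities $f_i(x,t)=\frac{d}{dx}\mathbb{P}\{X(t)<x,\mathscr{E}(t)=i\}$ satisfy, for $x>0$, $t>0$, $i=1,2$, $$\frac{\partial f_i}{\partial t}=-(\lambda_i^*-\mu_i^* )\frac{\partial f_i}{\partial x}+\frac{\omega_i^2}{2}\frac{\partial^2f_i}{\partial x^2}+\eta_{3-i}f_{3-i}-\eta_if_i,$$ the reflecting condition $\lim_{x\to0^+}\bigl[(\lambda_i^*-\mu_i^* )f_i-\frac{\omega_i^2}{2}\frac{\partial f_i}{\partial x}\bigr]=0$, the initial conditions $f_1(x,0^+)=p\,\delta(x-y)$, $f_2(x,0^+)=(1-p)\,\delta(x-y)$ ($\delta$ the Dirac delta), and $\int_0^\infty(f_1+f_2)\,dx=1$. The random vector ${\bf X}=(X,\mathscr{E})$ describes the steady-state regime, with densities $W_i(x)=\lim_{t\to+\infty}f_i(x,t)$.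 These satisfy $$-(\lambda_i^*-\mu_i^* )W_i'(x)+\frac{\omega_i^2}{2}W_i''(x)+\eta_{3-i}W_{3-i}(x)-\eta_iW_i(x)=0\quad(x>0),$$ $\lim_{x\to0^+}\bigl[(\lambda_i^*-\mu_i^* )W_i(x)-\frac{\omega_i^2}{2}W_i'(x)\bigr]=0$ for $i=1,2$, and $\int_0^\infty(W_1+W_2)\,dx=1$. *)

(* Defs.v *)
Set Warnings "-notation-overridden,-ambiguous-paths,-notation-incompatible-prefix".
From mathcomp Require Export all_boot all_order all_algebra.
From mathcomp Require Export all_classical all_reals all_analysis.

Set Implicit Arguments.
Unset Strict Implicit.
Unset Printing Implicit Defensive.

Import Order.TTheory GRing.Theory Num.Theory.
Import numFieldNormedType.Exports.

Local Open Scope classical_set_scope.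
Local Open Scope ring_scope.

(* The environments 1 and 2; [other i] is 3 - i. *)
Definition env1 : 'I_2 := ord0.
Definition env2 : 'I_2 := ord_max.
Definition other (i : 'I_2) : 'I_2 := rev_ord i.

Section Process.
Context (R : realType) (d : measure_display) (T : measurableType d)
        (P : probability T R).
Context (lambda mu omega eta : 'I_2 -> R) (p y : R).

Definition drift (i : 'I_2) : R := lambda i - mu i.

Definition init_weight (i : 'I_2) : R := if i == env1 then p else 1 - p.

(* Entry (i, j) of exp(t Q), where Q is the generator of the two-state chain
   leaving i at rate eta i. *)
Definition switch_prob (t : R) (i j : 'I_2) : R :=
  let s := eta env1 + eta env2 in
  if i == j then (eta (other i) + eta i * expR (- (s * t))) / s
  else eta i * (1 - expR (- (s * t))) / s.

(* [E] is a right-continuous Markov chain with switching rates [eta] and initial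
   law [init_weight], [B env1] and [B env2] are standard Brownian motions, and
   the three are mutually independent: [noise_law] gives their joint
   finite-dimensional laws.  The second argument of [normal_prob] is the standard
   deviation. *)
Record driving_noise (E : R -> T -> 'I_2) (B : 'I_2 -> R -> {RV P >-> R}) : Prop :=
  DrivingNoise {
  env_measurable : forall t i, measurable [set w | E t w = i];
  env_right_continuous : forall w t, 0 <= t -> \forall s \near t^'+, E s w = E t w;
  brownian_start : forall i w, B i 0 w = 0;
  brownian_continuous : forall i w,
    {within `[0, +oo[, continuous (fun t => B i t w)};
  noise_law : forall (n : nat) (t : nat -> R) (e : nat -> 'I_2)
      (A : 'I_2 -> nat -> set R),
    t 0%N = 0 -> (forall k, t k < t k.+1) -> (forall i k, measurable (A i k)) ->
    P [set w | (forall k, (k <= n)%N -> E (t k) w = e k) /\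
               (forall i k, (k < n)%N -> A i k (B i (t k.+1) w - B i (t k) w))] =
    ((init_weight (e 0%N) *
        \prod_(k < n) switch_prob (t k.+1 - t k) (e k) (e k.+1))%:E *
     \prod_(i < 2) \prod_(k < n)
        normal_prob 0 (Num.sqrt (t k.+1 - t k)) (A i k))%E
}.

Definition occupation (E : R -> T -> 'I_2) (i : 'I_2) (t : R) (w : T) : R :=
  \int[lebesgue_measure]_(s in `[0, t]) (E s w == i)%:R.

(* Running [B i] on the time spent in environment i makes the path evolve, while
   the environment is i, as a Wiener process with drift [drift i] and
   infinitesimal variance [omega i ^+ 2]. *)
Definition free_path (E : R -> T -> 'I_2) (B : 'I_2 -> R -> {RV P >-> R})
    (w : T) (t : R) : R :=
  y + \sum_(i < 2) (drift i * occupation E i t w +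
                    omega i * B i (occupation E i t w) w).

(* Skorokhod reflection at 0. *)
Definition reflect (z : R -> R) (t : R) : R :=
  z t + sup [set Num.max 0 (- z s) | s in `[0, t]].

Definition alternating_wiener (X : R -> {RV P >-> R}) (E : R -> T -> 'I_2) : Prop :=
  exists2 B : 'I_2 -> R -> {RV P >-> R}, driving_noise E B &
    forall t w, 0 <= t -> X t w = reflect (free_path E B w) t.

Record transient_densities (X : R -> {RV P >-> R}) (E : R -> T -> 'I_2)
    (f : 'I_2 -> R -> R -> R) : Prop := TransientDensities {
  transient_density : forall (i : 'I_2) (x t : R), 0 < x -> 0 < t ->
    is_derive x 1 (fun x' => fine (P [set w | X t w < x' /\ E t w = i])) (f i x t);
  transient_derivable : forall (i : 'I_2) (x t : R), 0 < x -> 0 < t ->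
    [/\ derivable (f i x) t 1, derivable (f i ^~ t) x 1 &
        derivable (derive1 (f i ^~ t)) x 1];
  transient_kolmogorov : forall (i : 'I_2) (x t : R), 0 < x -> 0 < t ->
    derive1 (f i x) t =
      - drift i * derive1 (f i ^~ t) x + omega i ^+ 2 / 2 * derive1n 2 (f i ^~ t) x
      + eta (other i) * f (other i) x t - eta i * f i x t;
  transient_reflecting : forall (i : 'I_2) (t : R), 0 < t ->
    drift i * f i x t - omega i ^+ 2 / 2 * derive1 (f i ^~ t) x @[x --> 0^'+] --> 0;
  (* f i (., t) dx tends weakly to [init_weight i] times the Dirac mass at y *)
  transient_initial : forall i (phi : R -> R), continuous phi ->
    (exists M, forall x, `|phi x| <= M) ->
    (\int[lebesgue_measure]_(x in `]0%R, +oo[) (phi x * f i x t)%:E)%E @[t --> 0^'+]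
      --> (init_weight i * phi y)%:E;
  transient_total : forall t : R, 0 < t ->
    (\int[lebesgue_measure]_(x in `]0%R, +oo[) (f env1 x t + f env2 x t)%:E = 1)%E
}.

Record steady_state_densities (f : 'I_2 -> R -> R -> R) (W : 'I_2 -> R -> R) : Prop :=
  SteadyStateDensities {
  steady_limit : forall (i : 'I_2) (x : R), 0 < x -> f i x t @[t --> +oo] --> W i x;
  steady_derivable : forall (i : 'I_2) (x : R), 0 < x ->
    derivable (W i) x 1 /\ derivable (derive1 (W i)) x 1;
  steady_kolmogorov : forall (i : 'I_2) (x : R), 0 < x ->
    - drift i * derive1 (W i) x + omega i ^+ 2 / 2 * derive1n 2 (W i) x
      + eta (other i) * W (other i) x - eta i * W i x = 0;
  steady_reflecting : forall i : 'I_2,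
    drift i * W i x - omega i ^+ 2 / 2 * derive1 (W i) x @[x --> 0^'+] --> 0;
  steady_total :
    (\int[lebesgue_measure]_(x in `]0%R, +oo[) (W env1 x + W env2 x)%:E = 1)%E
}.

Definition steady_poly : {poly R} :=
  (omega env1 ^+ 2 * omega env2 ^+ 2) *: 'X^3
  + (2 * (omega env1 ^+ 2 * (lambda env2 - mu env2)
          + omega env2 ^+ 2 * (lambda env1 - mu env1))) *: 'X^2
  - (2 * (omega env1 ^+ 2 * eta env2
          - 2 * (lambda env1 - mu env1) * (lambda env2 - mu env2)
          + omega env2 ^+ 2 * eta env1)) *: 'X
  - (4 * (eta env1 * (lambda env2 - mu env2)
          + eta env2 * (lambda env1 - mu env1)))%:P.

Definition steady_roots (xi1 xi2 xi3 : R) : Prop :=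
  [/\ root steady_poly xi1, root steady_poly xi2 & root steady_poly xi3] /\
  [/\ 0 < xi1, 0 < xi2, xi1 != xi2 & xi3 < 0].

Definition steady_denom (xi3 : R) (i : 'I_2) : R :=
  omega (other i) ^+ 2 * xi3 - 2 * (mu (other i) - lambda (other i)).

Definition steady_weight (xi1 xi2 xi3 : R) (i : 'I_2) : R :=
  4 * (eta env1 * (mu env2 - lambda env2) + eta env2 * (mu env1 - lambda env1))
    / (omega env1 ^+ 2 * omega env2 ^+ 2 * xi1 * xi3 * (xi1 - xi2))
  * ((omega (other i) ^+ 2 * (xi1 + xi3) - 2 * (mu (other i) - lambda (other i)))
     / steady_denom xi3 i).

End Process.

(* Main.v *)
Require Import Defs.
From mathcomp Require Import measurable_realfun ring lra.

Set Implicit Arguments.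
Unset Strict Implicit.
Unset Printing Implicit Defensive.

Import Order.TTheory GRing.Theory Num.Theory.
Import numFieldNormedType.Exports.

Local Open Scope classical_set_scope.
Local Open Scope ring_scope.

(** Write [s_i] for the infinitesimal variances, [b_i] for the drifts, [e_i]
    for the switching rates, and let [j] be the environment other than [i].

    Existence of the roots.  With [Q_i(z) = z (s_i z + 2 b_i)] the steady
    polynomial satisfies [z P(z) = (Q_1 - 2 e_1)(Q_2 - 2 e_2) - 4 e_1 e_2].
    Stability is exactly [0 < P(0)]; at the positive solution of
    [Q_1(z) = 2 e_1] the right-hand side is negative; and it is nonnegative as
    soon as both [Q_i(z) >= 4 e_i], that is, far out on either side.  The
    intermediate value theorem then places one root on the negative axis and
    two on the positive axis ([steady_roots_exist]).

    Shape of the densities.  The balance equations say that the flux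
    [F_i = s_i W_i' / 2 - b_i W_i] has derivative [e_i W_i - e_j W_j].  Hence
    [F_1 + F_2] is constant, and it is zero because both fluxes vanish at the
    boundary ([flux_opp]).  What remains is a linear system of order three in
    [(W_i, W_j, F_i)] whose characteristic polynomial is [P] up to the sign of
    the variable, so that [W_i] is a combination of the exponentials
    [exp (- xi_k x)], [k = 1, 2, 3] ([W_expsum3]).  The third exponential
    grows.  As [W_i] is nonnegative, being a limit of derivatives of
    distribution functions ([steady_density_ge0]), and as the total mass is
    finite, its coefficient is zero ([W_expsum2]).

    Coefficients.  The two that are left are determined by two linear
    equations: the reflecting condition ([reflecting_coef]) and the mass
    [e_j / (e_1 + e_2)] of environment [i] ([mass_balance]), which comes from
    integrating the flux equation over the half-line and from the
    normalisation.  Vieta's formulas turn the solution of these equations into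
    the announced weights ([steady_density_formula]). *)

(** * Linear differential equations on the half-line *)

Section HalfLine.
Context {R : realType}.
Implicit Types (u : R -> R) (x z : R).

Lemma near_eq_is_derive_pos (u v : R -> R) x du : 0 < x ->
  (forall t, 0 < t -> u t = v t) -> is_derive x 1 u du -> is_derive x 1 v du.
Proof.
move=> x0 uv; apply: near_eq_is_derive; near=> t; apply: uv.
by near: t; exact: lt_nbhsr.
Unshelve. all: by end_near. Qed.

Lemma derive0_pos_cst u : (forall x, 0 < x -> is_derive x 1 u 0) ->
  exists c, forall x, 0 < x -> u x = c.
Proof.
move=> du; exists (u 1).
have le_eq a b : 0 < a -> a <= b -> u a = u b.
  move=> a0 ab; have [| |c _] := @MVT_segment R u (fun=> 0) a b ab.
  - by move=> x /[!in_itv]/= /andP[ax _]; apply: du; exact: lt_trans ax.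
  - apply: derivable_within_continuous => x /[!in_itv]/= /andP[ax _].
    by have [] := du x (lt_le_trans a0 ax).
  by rewrite mul0r => /eqP; rewrite subr_eq0 => /eqP.
move=> x x0; case: (leP x 1) => [|/ltW] x1; first exact: le_eq.
by apply/esym; exact: le_eq.
Qed.

Lemma is_derive_expRM z x : is_derive x 1 (fun t => expR (z * t)) (z * expR (z * x)).
Proof.
have -> : (fun t => expR (z * t)) = expR \o (fun t => z *: t) by [].
rewrite mulrC; apply: is_derive1_comp.
by apply: is_derive_eq; rewrite /GRing.scale/= mulr1.
Qed.

Lemma first_order_solution u z :
  (forall x, 0 < x -> is_derive x 1 u (- z * u x)) ->
  exists c, forall x, 0 < x -> u x = c * expR (- z * x).
Proof.
move=> du; have [|c uc] := @derive0_pos_cst (fun x => u x * expR (z * x)).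
  move=> x /du dux; have dex := is_derive_expRM z x.
  apply: is_derive_eq; rewrite /GRing.scale/=; ring.
exists c => x /uc <-; rewrite -mulrA -expRD mulNr subrr expR0 mulr1 //.
Qed.

(** If [p], [q], [z] are the three exponents, [g'' + (p + q) g' + p q g]
    solves [u' = - z u].  The three combinations obtained this way recover [g]
    by Lagrange interpolation, since the exponents are distinct. *)
Lemma third_order_solution (g0 g1 g2 : R -> R) (z1 z2 z3 : R) :
  z1 != z2 -> z1 != z3 -> z2 != z3 ->
  (forall x, 0 < x -> is_derive x 1 g0 (g1 x)) ->
  (forall x, 0 < x -> is_derive x 1 g1 (g2 x)) ->
  (forall x, 0 < x -> is_derive x 1 g2
     (- ((z1 + z2 + z3) * g2 x + (z1 * z2 + z1 * z3 + z2 * z3) * g1 x +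
         z1 * z2 * z3 * g0 x))) ->
  exists c1 c2 c3, forall x, 0 < x ->
    g0 x = c1 * expR (- z1 * x) + c2 * expR (- z2 * x) + c3 * expR (- z3 * x).
Proof.
move=> z12 z13 z23 dg0 dg1 dg2.
pose u (p q x : R) := g2 x + (p + q) * g1 x + p * q * g0 x.
have du p q z : p + q + z = z1 + z2 + z3 ->
    p * q + p * z + q * z = z1 * z2 + z1 * z3 + z2 * z3 ->
    p * q * z = z1 * z2 * z3 ->
    exists c, forall x, 0 < x -> u p q x = c * expR (- z * x).
  move=> e1 e2 e3; apply: first_order_solution => x x0.
  move: (dg0 _ x0) (dg1 _ x0) (dg2 _ x0) => d0 d1 d2.
  apply: is_derive_eq; rewrite /GRing.scale/= /u -e1 -e2 -e3; ring.
have [c1 u1] : exists c, forall x, 0 < x -> u z2 z3 x = c * expR (- z1 * x).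
  by apply: du; ring.
have [c2 u2] : exists c, forall x, 0 < x -> u z1 z3 x = c * expR (- z2 * x).
  by apply: du; ring.
have [c3 u3] : exists c, forall x, 0 < x -> u z1 z2 x = c * expR (- z3 * x).
  by apply: du; ring.
exists (c1 / ((z2 - z1) * (z3 - z1))), (c2 / ((z1 - z2) * (z3 - z2))),
  (c3 / ((z1 - z3) * (z2 - z3))) => x x0.
rewrite ![_ / _ * _]mulrAC -u1// -u2// -u3// /u.
by field; rewrite !subr_eq0 !(eq_sym _ z1) (eq_sym z3) z12 z13 z23.
Qed.

(** Adding [e t] to [u] makes it strictly increasing, so that [0 <= du + e] for
    every positive [e]. *)
Lemma nondecreasing_is_derive_ge0 u x du : 0 < x ->
  (forall t, 0 < t -> derivable u t 1) ->
  {homo u : s t / s <= t} -> is_derive x 1 u du -> 0 <= du.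
Proof.
move=> x0 derv mono dux; apply/ler_addgt0Pl => e e0.
have dv : is_derive x 1 (fun t => u t + e *: t) (du + e).
  by apply: is_derive_eq; rewrite /GRing.scale/= mulr1.
have := @incr_derive1_ge0_itvy R (fun t => u t + e *: t) true 0 x.
rewrite derive1E (@derive_val _ _ _ _ _ _ _ dv) addrC; apply.
- move=> t /[!inE]/=; rewrite in_itv/= andbT => /derv dt.
  by apply: derivableD => //; exact: ex_derive.
- by move=> s t _ _ st; apply: ler_ltD; [exact/mono/ltW|rewrite ltr_pM2l].
- by rewrite in_itv/= x0.
Qed.

Lemma cvg0_expR z : expR (- z * x) @[x --> 0^'+] --> (1 : R).
Proof.
rewrite -[X in _ --> X]expR0 -[X in _ --> expR X](mulr0 (- z)).
have [dexp _] := is_derive_expRM (- z) 0.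
apply: cvg_at_right_filter.
by have := differentiable_continuous (iffLR (derivable1_diffP _ _) dexp).
Qed.

Lemma cvgy_expR z : 0 < z -> expR (- z * x) @[x --> +oo] --> (0 : R).
Proof.
move=> z0; under eq_fun do rewrite mulNr.
apply: (cvg_comp (fun x => z * x) (fun x => expR (- x))); last exact: cvgr_expR.
exact: gt0_cvgMry.
Qed.

Lemma expsum_cvg0 (z1 z2 a1 a2 : R) :
  a1 * expR (- z1 * x) + a2 * expR (- z2 * x) @[x --> 0^'+] --> a1 + a2.
Proof.
rewrite -[X in _ --> X + _]mulr1 -[X in _ --> _ + X]mulr1.
by apply: cvgD; apply: cvgMr; exact: cvg0_expR.
Qed.

(** The constant is the limit of the sum at 0 and also at infinity. *)
Lemma expsum_cst_eq0 (z1 z2 a1 a2 c : R) : 0 < z1 -> 0 < z2 ->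
  (forall x, 0 < x -> a1 * expR (- z1 * x) + a2 * expR (- z2 * x) = c) ->
  a1 + a2 = 0.
Proof.
move=> z1_gt0 z2_gt0 h.
have at0 := @expsum_cvg0 z1 z2 a1 a2.
have aty : a1 * expR (- z1 * x) + a2 * expR (- z2 * x) @[x --> +oo] --> (0 : R).
  rewrite -[0](addr0 0) -[X in _ --> X + _](mulr0 a1) -[X in _ --> _ + X](mulr0 a2).
  by apply: cvgD; apply: cvgMr; exact: cvgy_expR.
transitivity c.
  apply: (@cvg_unique R _ _ _ _ _ at0) => //.
  apply: cvg_near_cst; near=> x; exact: h.
apply: (@cvg_unique R _ _ _ _ _ _ aty) => //.
apply: cvg_near_cst; near=> x; exact: h.
Unshelve. all: by end_near. Qed.

End HalfLine.

(** * Mass of sums of exponentials *)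

Section Mass.
Context {R : realType}.

(** The decaying terms are bounded by [|c1| + |c2|], and the growing one is at
    least [|c3| (1 - z3 x)] by convexity of the exponential; comparing these
    linear bounds gives the threshold [M]. *)
Lemma expsum_ge1_eventually (z1 z2 z3 c1 c2 c3 : R) :
  0 < z1 -> 0 < z2 -> z3 < 0 -> c3 != 0 ->
  exists2 M, 0 < M & forall x, M < x ->
    1 <= `|c1 * expR (- z1 * x) + c2 * expR (- z2 * x) + c3 * expR (- z3 * x)|.
Proof.
move=> z1_gt0 z2_gt0 z3_lt0 c3_neq0.
have nc3 : 0 < `|c3| by rewrite normr_gt0.
have kc3 : 0 < `|c3| * - z3 by rewrite mulr_gt0// oppr_gt0.
exists ((1 + `|c1| + `|c2|) / (`|c3| * - z3)).
  by rewrite divr_gt0// -addrA ltr_wpDr// addr_ge0.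
move=> x; rewrite ltr_pdivrMr// => Mx.
have x_gt0 : 0 < x.
  rewrite -(pmulr_lgt0 _ kc3); apply: le_lt_trans Mx.
  by rewrite !addr_ge0.
have decay z c : 0 < z -> `|c * expR (- z * x)| <= `|c|.
  move=> z_gt0; rewrite normrM ler_piMr// ger0_norm ?expR_ge0//.
  by rewrite -expR0 ler_expR mulNr oppr_le0 mulr_ge0// ltW.
have growth : `|c3| * (1 - z3 * x) <= `|c3 * expR (- z3 * x)|.
  rewrite normrM ler_wpM2l// ger0_norm ?expR_ge0//.
  by rewrite -mulNr; exact: expR_ge1Dx.
have := decay _ c1 z1_gt0; have := decay _ c2 z2_gt0.
set u := c1 * _; set v := c2 * _; set w := c3 * _ in growth * => hv hu.
have : `|w| <= `|u + v + w| + (`|u| + `|v|).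
  rewrite {1}(_ : w = (u + v + w) - (u + v)); last by ring.
  by apply: le_trans (ler_normB _ _) _; rewrite lerD2l ler_normD.
move: growth; rewrite mulrBr mulr1; nra.
Qed.

Lemma integral_eventually_ge1 (g : R -> R) (M : R) :
  measurable_fun (`]0, +oo[%classic : set R) g -> (forall x : R, 0 < x -> 0 <= g x) ->
  0 < M -> (forall x, M < x -> 1 <= g x) ->
  (\int[lebesgue_measure]_(x in `]0%R, +oo[) (g x)%:E = +oo)%E.
Proof.
move=> mg g_ge0 M_gt0 g_ge1; apply/eqP; rewrite -leye_eq.
have sub : (`]M, +oo[%classic : set R) `<=` `]0, +oo[%classic.
  by move=> x /=; rewrite !in_itv/= !andbT; exact: lt_trans.
have -> : +oo%E = (\int[lebesgue_measure]_(x in `]M, +oo[) (cst 1 x))%E.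
  by rewrite integral_cst//= lebesgue_measure_itv/= ltry mul1e addye.
apply: (@le_trans _ _ (\int[lebesgue_measure]_(x in `]M, +oo[) (g x)%:E)%E).
  apply: ge0_le_integral => //=.
  - apply/measurable_EFinP; exact: measurable_funS mg.
  - by move=> x; rewrite in_itv/= andbT lee_fin; exact: g_ge1.
apply: ge0_subset_integral => //; first exact/measurable_EFinP.
by move=> x /=; rewrite in_itv/= andbT lee_fin; exact: g_ge0.
Qed.

Lemma integral0y_exponential_pdf (z : R) : 0 < z ->
  (\int[lebesgue_measure]_(x in `]0%R, +oo[) (exponential_pdf z x)%:E = 1)%E.
Proof.
move=> z_gt0; rewrite -(integral_exponential_pdf z_gt0).
rewrite integral_itv_obnd_cbnd; last first.
  apply/measurable_EFinP/measurable_funTS; exact: measurable_exponential_pdf.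
rewrite integral_mkcond; apply: eq_integral => x _.
rewrite patchE; case: ifPn => // xN; rewrite lt0_exponential_pdf//.
by move: xN; rewrite notin_setE/= in_itv/= andbT => /negP; rewrite -ltNge.
Qed.

(** Integrability comes from the exponential densities, of which the sum is a
    linear combination. *)
Lemma integral_expsum (z1 z2 a1 a2 : R) (g : R -> R) : 0 < z1 -> 0 < z2 ->
  (forall x, 0 < x -> g x = a1 * expR (- z1 * x) + a2 * expR (- z2 * x)) ->
  (\int[lebesgue_measure]_(x in `]0%R, +oo[) (g x)%:E =
     (a1 / z1 + a2 / z2)%:E)%E.
Proof.
move=> z1_gt0 z2_gt0 gE.
have int z a : 0 < z -> lebesgue_measure.-integrable `]0, +oo[
    (fun x => (a / z)%:E * (exponential_pdf z x)%:E)%E.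
  move=> z_gt0; apply: integrableZl => //.
  by apply: integrableS (integrable_exponential_pdf z_gt0).
under eq_integral => x.
  rewrite inE/= in_itv/= andbT => x_gt0; rewrite gE//.
  have -> : (a1 * expR (- z1 * x) + a2 * expR (- z2 * x))%:E =
    ((a1 / z1)%:E * (exponential_pdf z1 x)%:E +
     (a2 / z2)%:E * (exponential_pdf z2 x)%:E)%E.
    rewrite !exponential_pdfE ?ltW// -!EFinM -EFinD !mulrA !divfK//;
      exact: lt0r_neq0.
  over.
rewrite integralD//=; [|exact: int..].
rewrite !integralZl//; try by apply: integrableS (integrable_exponential_pdf _).
by rewrite !integral0y_exponential_pdf// !mule1.
Qed.

End Mass.

(** * Roots of the steady polynomial *)

Section Roots.
Context {R : realType}.

Lemma env_cases (i : 'I_2) : i = env1 \/ i = env2.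
Proof. by case: i => -[|[|//]] h; [left|right]; exact/val_inj. Qed.

Lemma other1 : other env1 = env2. Proof. exact/val_inj. Qed.
Lemma other2 : other env2 = env1. Proof. exact/val_inj. Qed.
Lemma otherK : involutive other. Proof. exact: rev_ordK. Qed.

(** Multiplied by [z / 4], this is the determinant of the balance equations at
    [exp (- z x)]; the form displays the symmetry between the environments. *)
Lemma steady_polyE (lambda mu omega eta : 'I_2 -> R) (i : 'I_2) (z : R) :
  (steady_poly lambda mu omega eta).[z] =
  z * (omega i ^+ 2 * z + 2 * drift lambda mu i) *
      (omega (other i) ^+ 2 * z + 2 * drift lambda mu (other i))
  - 2 * eta i * (omega (other i) ^+ 2 * z + 2 * drift lambda mu (other i))
  - 2 * eta (other i) * (omega i ^+ 2 * z + 2 * drift lambda mu i).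
Proof.
rewrite /steady_poly /drift !(hornerD, hornerN, hornerZ, hornerXn, hornerX, hornerC).
by case: (env_cases i) => ->; rewrite ?other1 ?other2; ring.
Qed.

(** Beyond its positive crossing of the level [m] the quadratic is the product
    of two positive increasing factors, hence stays above [m]. *)
Lemma quadratic_level (s b m : R) : 0 < s -> 0 < m ->
  exists2 r, 0 < r & r * (s * r + 2 * b) = m /\
    forall z, r <= z -> m <= z * (s * z + 2 * b).
Proof.
move=> s_gt0 m_gt0.
pose D := b ^+ 2 + s * m.
have D_gt : b ^+ 2 < D by rewrite ltrDl mulr_gt0.
have D_ge0 : 0 <= D by rewrite (le_trans (sqr_ge0 b))// ltW.
have sqrtD : Num.sqrt D ^+ 2 = D by exact: sqr_sqrtr.
have sqrtD_gt : b < Num.sqrt D.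
  apply: le_lt_trans (ler_norm b) _.
  by rewrite -sqrtr_sqr ltr_sqrt// (le_lt_trans (sqr_ge0 b)).
pose r := (Num.sqrt D - b) / s.
have r_gt0 : 0 < r by rewrite divr_gt0// subr_gt0.
have rE : r * (s * r + 2 * b) = m.
  rewrite -[RHS](mulKf (lt0r_neq0 s_gt0)).
  have -> : s * m = Num.sqrt D ^+ 2 - b ^+ 2 by rewrite sqrtD /D; ring.
  by rewrite /r; field; exact: lt0r_neq0.
exists r => //; split=> // z rz.
have slope_gt0 : 0 < s * r + 2 * b by rewrite -(pmulr_rgt0 _ r_gt0) rE.
by rewrite -[leLHS]rE ler_pM ?(ltW r_gt0) ?(ltW slope_gt0)// lerD2r ler_pM2l.
Qed.

(** Subtracting the equations of two roots and dividing by their difference,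
    twice, yields the coefficients one after the other. *)
Lemma vieta3 (a b c d x y z : R) : x != y -> x != z -> y != z ->
  (forall t, t \in [:: x; y; z] -> a * t ^+ 3 + b * t ^+ 2 + c * t + d = 0) ->
  [/\ b = - a * (x + y + z), c = a * (x * y + x * z + y * z)
    & d = - a * (x * y * z)].
Proof.
move=> xy xz yz root.
have rx : a * x ^+ 3 + b * x ^+ 2 + c * x + d = 0 by apply: root; rewrite !inE eqxx.
have ry : a * y ^+ 3 + b * y ^+ 2 + c * y + d = 0 by apply: root; rewrite !inE eqxx orbT.
have rz : a * z ^+ 3 + b * z ^+ 2 + c * z + d = 0 by apply: root; rewrite !inE eqxx !orbT.
have dxy : a * (x ^+ 2 + x * y + y ^+ 2) + b * (x + y) + c = 0.
  apply: (mulfI (_ : x - y != 0)); rewrite ?subr_eq0// mulr0 -(subrr 0) -{1}rx -ry; ring.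
have dxz : a * (x ^+ 2 + x * z + z ^+ 2) + b * (x + z) + c = 0.
  apply: (mulfI (_ : x - z != 0)); rewrite ?subr_eq0// mulr0 -(subrr 0) -{1}rx -rz; ring.
have bE : b = - a * (x + y + z).
  apply: (mulfI (_ : y - z != 0)); rewrite ?subr_eq0//.
  apply/eqP; rewrite -subr_eq0 -(subrr 0) -{1}dxy -dxz; apply/eqP; ring.
have cE : c = a * (x * y + x * z + y * z).
  by apply/eqP; rewrite -subr_eq0 -dxy bE; apply/eqP; ring.
split=> //; apply/eqP; rewrite -subr_eq0 -rx bE cE; apply/eqP; ring.
Qed.

(** The sign of [P] is read off [z P(z)], see [zP], at 0, at the solution [r] of
    [Q_1(r) = 2 e_1], and at points [p] and [- n] so far out that both [Q_i]
    exceed [4 e_i]. *)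
Lemma steady_roots_exist (lambda mu omega eta : 'I_2 -> R) :
  (forall i, 0 < omega i ^+ 2) -> (forall i, 0 < eta i) ->
  0 < eta env1 * (mu env2 - lambda env2) + eta env2 * (mu env1 - lambda env1) ->
  exists xi1 xi2 xi3, steady_roots lambda mu omega eta xi1 xi2 xi3.
Proof.
move=> s_gt0 e_gt0 stable.
pose P := steady_poly lambda mu omega eta.
pose s i := omega i ^+ 2; pose b i := drift lambda mu i.
have zP z : z * P.[z] = (z * (s env1 * z + 2 * b env1) - 2 * eta env1) *
    (z * (s env2 * z + 2 * b env2) - 2 * eta env2) - 4 * eta env1 * eta env2.
  by rewrite (steady_polyE _ _ _ _ env1) other1 /s /b; ring.
have P0 : 0 < P.[0].
  rewrite (steady_polyE _ _ _ _ env1) other1 /drift !mulr0 !mul0r !add0r; lra.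
have [r r_gt0 [rE _]] := quadratic_level (b env1) (s_gt0 env1)
  (mulr_gt0 (ltr0Sn R 1) (e_gt0 env1)).
have Pr : P.[r] < 0.
  rewrite -(pmulr_rlt0 _ r_gt0) zP rE subrr mul0r sub0r oppr_lt0.
  by rewrite !mulr_gt0.
have e4 i : 0 < 4 * eta i by rewrite mulr_gt0.
have big z : (forall i, 4 * eta i <= z * (s i * z + 2 * b i)) -> 0 <= z * P.[z].
  move=> h; rewrite zP; have := h env1; have := h env2.
  have := e_gt0 env1; have := e_gt0 env2; nra.
have [p1 p1_gt0 [_ p1P]] := quadratic_level (b env1) (s_gt0 env1) (e4 env1).
have [p2 p2_gt0 [_ p2P]] := quadratic_level (b env2) (s_gt0 env2) (e4 env2).
have [n1 n1_gt0 [_ n1P]] := quadratic_level (- b env1) (s_gt0 env1) (e4 env1).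
have [n2 n2_gt0 [_ n2P]] := quadratic_level (- b env2) (s_gt0 env2) (e4 env2).
pose p := Num.max r (Num.max p1 p2); pose n := Num.max n1 n2.
have p_gt0 : 0 < p by rewrite !lt_max r_gt0.
have n_gt0 : 0 < n by rewrite !lt_max n1_gt0.
have Pp : 0 <= P.[p].
  rewrite -(pmulr_rge0 _ p_gt0); apply: big => i.
  by case: (env_cases i) => ->; [apply: p1P|apply: p2P];
    rewrite /p !le_max lexx !orbT.
have Pn : P.[- n] <= 0.
  rewrite -oppr_ge0 -(pmulr_rge0 _ n_gt0) mulrN -mulNr; apply: big => i.
  have -> : - n * (s i * - n + 2 * b i) = n * (s i * n + 2 * - b i) by ring.
  by case: (env_cases i) => ->; [apply: n1P|apply: n2P];
    rewrite /n !le_max lexx ?orbT.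
have [x1 /andP[x1_ge0 x1r] rx1] : exists2 x, 0 <= x <= r & root P x.
  have [||x x0r] := @poly_ivt R (- P) 0 r; first exact: ltW.
    by rewrite !hornerN oppr_le0 oppr_ge0 !ltW.
  by rewrite rootN => ?; exists x.
have [x2 /andP[rx2 x2p] r2] : exists2 x, r <= x <= p & root P x.
  apply: poly_ivt; first by rewrite le_max lexx.
  by rewrite Pp ltW.
have [x3 /andP[_ x3_le0] r3] : exists2 x, - n <= x <= 0 & root P x.
  apply: poly_ivt; first by rewrite oppr_le0 ltW.
  by rewrite Pn ltW.
have x_neq0 x : root P x -> x != 0.
  by apply: contraTneq => ->; rewrite /root gt_eqF.
have x_neqr x : root P x -> x != r.
  by apply: contraTneq => ->; rewrite /root lt_eqF.
exists x1, x2, x3; split; split => //.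
- by rewrite lt_def x_neq0.
- exact: lt_le_trans rx2.
- by rewrite lt_eqF// (lt_le_trans _ rx2)// lt_neqAle x_neqr.
- by rewrite lt_neqAle x_neq0.
Qed.

End Roots.

(** * Nonnegativity of the densities *)

Section Densities.
Context {R : realType} {d : measure_display} {T : measurableType d}
  {P : probability T R}.
Implicit Types (i : 'I_2) (x t : R).
Context {lambda mu omega eta : 'I_2 -> R} {p y : R}.
Context {X : R -> {RV P >-> R}} {E : R -> T -> 'I_2}.
Context {f : 'I_2 -> R -> R -> R} {W : 'I_2 -> R -> R}.

(** A transient density is the derivative of a nondecreasing function of [x], the
    probability of [X t < x] jointly with the environment. *)
Lemma transient_density_ge0 :
  alternating_wiener lambda mu omega eta p y X E ->
  transient_densities lambda mu omega eta p y X E f ->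
  forall i x t, 0 < x -> 0 < t -> 0 <= f i x t.
Proof.
move=> [B noise _] hf i x t x0 t0.
have mS a : measurable [set w | X t w < a /\ E t w = i].
  have -> : [set w | X t w < a /\ E t w = i] =
      X t @^-1` `]-oo, a[ `&` [set w | E t w = i].
    by apply/seteqP; split=> w /=; rewrite in_itv.
  apply: measurableI; last exact: env_measurable noise t i.
  by rewrite -[X in measurable X]setTI; exact: measurable_funP.
apply: (nondecreasing_is_derive_ge0 x0) (transient_density hf i x0 t0).
  by move=> s s0; have [] := transient_density hf i s0 t0.
move=> a b ab; apply: fine_le; rewrite ?fin_num_measure//.
apply: le_measure; rewrite ?inE// => w /= [Xa Ei]; split=> //.
exact: lt_le_trans ab.
Qed.

Lemma steady_density_ge0 :
  alternating_wiener lambda mu omega eta p y X E ->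
  transient_densities lambda mu omega eta p y X E f ->
  steady_state_densities lambda mu omega eta f W ->
  forall i x, 0 < x -> 0 <= W i x.
Proof.
move=> hX hf hW i x x0.
have fW := @steady_limit _ _ _ _ _ _ _ hW i x x0.
rewrite -(cvg_lim _ fW)//; apply: limr_ge; first by apply/cvg_ex; exists (W i x).
near=> t; apply: transient_density_ge0 hX hf _ _ _ x0 _.
by near: t; apply: nbhs_pinfty_gt; rewrite num_real.
Unshelve. all: by end_near. Qed.

End Densities.

(** * The stationary balance equations *)

Section Stationary.
Context {R : realType}.
Implicit Types (i : 'I_2) (x : R).
Context {lambda mu omega eta : 'I_2 -> R}.
Context {f : 'I_2 -> R -> R -> R} {W : 'I_2 -> R -> R}.
Context (s_gt0 : forall i, 0 < omega i ^+ 2) (eta_gt0 : forall i, 0 < eta i).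
Context (hW : steady_state_densities lambda mu omega eta f W).
Context (W_ge0 : forall i x, 0 < x -> 0 <= W i x).

Local Notation b := (drift lambda mu).

(** Minus the probability current of environment [i]: the reflecting condition is
    that it vanishes at 0. *)
Definition flux (i : 'I_2) (x : R) : R :=
  omega i ^+ 2 / 2 * derive1 (W i) x - b i * W i x.

Lemma omega_neq0 i : omega i != 0.
Proof. by rewrite -sqrf_eq0 lt0r_neq0. Qed.

Lemma is_derive_W i x : 0 < x ->
  is_derive x 1 (W i) (2 / omega i ^+ 2 * (flux i x + b i * W i x)).
Proof.
move=> x0; have [dW _] := steady_derivable hW i x0.
apply: DeriveDef => //; rewrite -derive1E /flux; field.
exact: omega_neq0.
Qed.

Lemma is_derive_flux i x : 0 < x ->
  is_derive x 1 (flux i) (eta i * W i x - eta (other i) * W (other i) x).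
Proof.
move=> x0; have [dW ddW] := steady_derivable hW i x0.
have h1 : is_derive x 1 (W i) (derive1 (W i) x).
  by apply: DeriveDef => //; rewrite derive1E.
have h2 : is_derive x 1 (derive1 (W i)) (derive1n 2 (W i) x).
  by apply: DeriveDef => //; rewrite [RHS]/= derive1E.
have ode := steady_kolmogorov hW i x0.
have -> : flux i = (fun t => (omega i ^+ 2 / 2) *: derive1 (W i) t - b i *: W i t).
  by [].
apply: is_derive_eq; apply/eqP; rewrite -subr_eq0 -ode /GRing.scale/=.
apply/eqP; ring.
Qed.

Lemma flux_cvg0 i : flux i x @[x --> 0^'+] --> (0 : R).
Proof.
rewrite -[X in _ --> X]oppr0 (_ : flux i = fun x => - (b i * W i x -
  omega i ^+ 2 / 2 * derive1 (W i) x)); last first.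
  by apply/funext => x; rewrite /flux opprB.
by apply: cvgN; exact: (@steady_reflecting _ _ _ _ _ _ _ hW).
Qed.

(** What leaves one environment enters the other, so the sum of the fluxes is
    constant, and reflection makes this constant zero. *)
Lemma flux_opp i x : 0 < x -> flux (other i) x = - flux i x.
Proof.
move=> x0.
have [|c cE] := @derive0_pos_cst _ (fun x => flux i x + flux (other i) x).
  move=> t t0; have d1 := is_derive_flux i t0.
  have d2 := is_derive_flux (other i) t0.
  by apply: is_derive_eq; rewrite otherK; ring.
suff c0 : c = 0 by apply/eqP; rewrite -addr_eq0 addrC cE// c0.
have lim0 : flux i x + flux (other i) x @[x --> 0^'+] --> (0 : R).
  by rewrite -[X in _ --> X]addr0; apply: cvgD; exact: flux_cvg0.
apply: (@cvg_unique R _ _ _ _ _ _ lim0) => //.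
apply: cvg_near_cst; near=> t; exact: cE.
Unshelve. all: by end_near. Qed.

Context (stable : 0 < eta env1 * (mu env2 - lambda env2)
                   + eta env2 * (mu env1 - lambda env1)).
Context (xi1 xi2 xi3 : R) (roots : steady_roots lambda mu omega eta xi1 xi2 xi3).

Let xi1_gt0 : 0 < xi1. Proof. by case: roots => _ []. Qed.
Let xi2_gt0 : 0 < xi2. Proof. by case: roots => _ []. Qed.
Let xi3_lt0 : xi3 < 0. Proof. by case: roots => _ []. Qed.
Let xi12 : xi1 != xi2. Proof. by case: roots => _ []. Qed.
Let xi13 : xi1 != xi3. Proof. by rewrite gt_eqF// (lt_trans xi3_lt0). Qed.
Let xi23 : xi2 != xi3. Proof. by rewrite gt_eqF// (lt_trans xi3_lt0). Qed.

Local Notation s := (fun i => omega i ^+ 2).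

Lemma stability_envE i :
  eta env1 * (mu env2 - lambda env2) + eta env2 * (mu env1 - lambda env1) =
  - (eta i * b (other i) + eta (other i) * b i).
Proof. by rewrite /drift; case: (env_cases i) => ->; rewrite ?other1 ?other2; ring. Qed.

(** If one of [s_i xi3 + 2 b_i] vanished at the root [xi3], so would the other;
    then both drifts would be positive, against stability.  This is where the
    sign of [xi3] matters: the factors can vanish at a positive root. *)
Lemma steady_denom_neq0 i : steady_denom lambda mu omega xi3 i != 0.
Proof.
have [[_ _ /eqP]] := roots; rewrite (steady_polyE _ _ _ _ i) => P3 _.
have -> : steady_denom lambda mu omega xi3 i =
    omega (other i) ^+ 2 * xi3 + 2 * b (other i) by rewrite /steady_denom /drift; ring.
apply/eqP => d0; move: P3; rewrite d0 !mulr0 subr0 sub0r => /eqP.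
rewrite oppr_eq0 mulf_eq0 mulf_eq0 pnatr_eq0/= (gt_eqF (eta_gt0 _))/= => /eqP d1.
move: stable; rewrite (stability_envE i).
have := mulr_gt0 (s_gt0 i) (eta_gt0 (other i)).
have := mulr_gt0 (s_gt0 (other i)) (eta_gt0 i).
move: (omega i ^+ 2) (omega (other i) ^+ 2) d0 d1 => si sj d0 d1 h1 h2.
have -> : b (other i) = - (sj * xi3) / 2 by lra.
have -> : b i = - (si * xi3) / 2 by lra.
have := xi3_lt0; nra.
Qed.

Lemma steady_vieta i :
  [/\ s i * s (other i) * (xi1 + xi2 + xi3) = - (2 * (s i * b (other i) + s (other i) * b i)),
      s i * s (other i) * (xi1 * xi2 + xi1 * xi3 + xi2 * xi3) =
        4 * b i * b (other i) - 2 * (s i * eta (other i) + s (other i) * eta i)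
    & s i * s (other i) * (xi1 * xi2 * xi3) =
        4 * (eta i * b (other i) + eta (other i) * b i)].
Proof.
have [|e1 e2 e3] := @vieta3 R (s i * s (other i))
  (2 * (s i * b (other i) + s (other i) * b i))
  (4 * b i * b (other i) - 2 * (s i * eta (other i) + s (other i) * eta i))
  (- (4 * (eta i * b (other i) + eta (other i) * b i))) _ _ _ xi12 xi13 xi23.
  have [[/eqP r1 /eqP r2 /eqP r3] _] := roots.
  by move=> t; rewrite !inE => /or3P[] /eqP ->;
    [rewrite -r1|rewrite -r2|rewrite -r3]; rewrite (steady_polyE _ _ _ _ i); ring.
split; first by rewrite e1; ring.
  by rewrite e2.
by apply: oppr_inj; rewrite e3; ring.
Qed.

(** Eliminating [W_j] and the flux from the first-order system in
    [(W_i, W_j, flux i)] gives [W_i] a third-order equation, whose coefficients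
    are the symmetric functions of the roots by Vieta's formulas.  Elimination
    works even when an eigenvector of the system degenerates. *)
Lemma W_expsum3 i : exists c1 c2 c3, forall x, 0 < x ->
  W i x = c1 * expR (- xi1 * x) + c2 * expR (- xi2 * x) + c3 * expR (- xi3 * x).
Proof.
(* [g1] and [g2] are the first two derivatives of [W i] as the first-order system
   expresses them, [dWj] the derivative of [W (other i)]. *)
pose g1 x := 2 / s i * (flux i x + b i * W i x).
pose dF x := eta i * W i x - eta (other i) * W (other i) x.
pose g2 x := 2 / s i * (dF x + b i * g1 x).
pose dWj x := 2 / s (other i) * (- flux i x + b (other i) * W (other i) x).
have dW x : 0 < x -> is_derive x 1 (W i) (g1 x) by exact: is_derive_W.
have dg1 x : 0 < x -> is_derive x 1 g1 (g2 x).
  move=> x0; have h1 := dW _ x0; have h2 := is_derive_flux i x0.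
  have -> : g1 = (fun x => (2 / s i) *: (flux i x + b i *: W i x)) by [].
  by apply: is_derive_eq; rewrite /GRing.scale/= /g2 /dF.
apply: (@third_order_solution _ (W i) g1 g2) => // x x0.
have h1 := dW _ x0; have h2 := dg1 _ x0.
have h3 : is_derive x 1 (W (other i)) (dWj x).
  by have := is_derive_W (other i) x0; rewrite flux_opp.
have -> : g2 = (fun x => (2 / s i) *: (eta i *: W i x - eta (other i) *: W (other i) x
  + b i *: g1 x)) by [].
apply: is_derive_eq; rewrite /GRing.scale/=.
have [v1 v2 v3] := steady_vieta i.
have ss : s i * s (other i) != 0 by rewrite mulf_neq0 ?lt0r_neq0.
apply: (mulfI ss).
transitivity (- ((s i * s (other i) * (xi1 + xi2 + xi3)) * g2 x +
  (s i * s (other i) * (xi1 * xi2 + xi1 * xi3 + xi2 * xi3)) * g1 x +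
  (s i * s (other i) * (xi1 * xi2 * xi3)) * W i x)); last first.
  by rewrite /g2 /dF; ring.
rewrite v1 v2 v3 /g2 /dWj /dF /g1.
by field; rewrite !omega_neq0.
Qed.

(** Nonnegativity of each density is essential: the growing terms of [W_1] and
    [W_2] could otherwise cancel in the normalised sum. *)
Lemma W_expsum2 i : exists a1 a2, forall x, 0 < x ->
  W i x = a1 * expR (- xi1 * x) + a2 * expR (- xi2 * x).
Proof.
have [a1 [a2 [a3 WE]]] := W_expsum3 i.
have [a30|a3_neq0] := eqVneq a3 0.
  by exists a1, a2 => x x0; rewrite WE// a30 mul0r addr0.
have [M M0 hM] := expsum_ge1_eventually a1 a2 xi1_gt0 xi2_gt0 xi3_lt0 a3_neq0.
pose S x := W env1 x + W env2 x.
have S_ge0 x : 0 < x -> 0 <= S x by move=> x0; rewrite addr_ge0// W_ge0.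
have mS : measurable_fun (`]0, +oo[%classic : set R) S.
  apply: open_continuous_measurable_fun => // x.
  rewrite inE/= in_itv/= andbT => x0.
  have [dW1 _] := steady_derivable hW env1 x0.
  have [dW2 _] := steady_derivable hW env2 x0.
  exact: differentiable_continuous (iffLR (derivable1_diffP _ _) (derivableD dW1 dW2)).
have : (\int[lebesgue_measure]_(x in `]0%R, +oo[) (S x)%:E = +oo)%E.
  apply: (integral_eventually_ge1 mS S_ge0 M0) => x Mx.
  have x0 : 0 < x by exact: lt_trans Mx.
  have : 1 <= W i x by rewrite -[leRHS]ger0_norm ?W_ge0// WE//; exact: hM.
  have := W_ge0 env1 x0; have := W_ge0 env2 x0.
  by rewrite /S; case: (env_cases i) => ->; lra.
by rewrite (steady_total hW).
Qed.

Lemma flux_expsum2 i (a1 a2 : R) :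
  (forall x, 0 < x -> W i x = a1 * expR (- xi1 * x) + a2 * expR (- xi2 * x)) ->
  forall x, 0 < x ->
  flux i x = (- (s i * xi1 + 2 * b i) / 2 * a1) * expR (- xi1 * x) +
             (- (s i * xi2 + 2 * b i) / 2 * a2) * expR (- xi2 * x).
Proof.
move=> WE x x0; rewrite /flux WE//.
suff -> : derive1 (W i) x = - xi1 * a1 * expR (- xi1 * x) - xi2 * a2 * expR (- xi2 * x).
  by field.
rewrite derive1E; apply: derive_val.
apply: (near_eq_is_derive_pos x0 (fun t t0 => esym (WE t t0))).
have h1 := is_derive_expRM (- xi1) x; have h2 := is_derive_expRM (- xi2) x.
have -> : (fun t => a1 * expR (- xi1 * t) + a2 * expR (- xi2 * t)) =
  (fun t => a1 *: expR (- xi1 * t) + a2 *: expR (- xi2 * t)) by [].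
by apply: is_derive_eq; rewrite /GRing.scale/=; ring.
Qed.

Lemma reflecting_coef i (a1 a2 : R) :
  (forall x, 0 < x -> W i x = a1 * expR (- xi1 * x) + a2 * expR (- xi2 * x)) ->
  (s i * xi1 + 2 * b i) * a1 + (s i * xi2 + 2 * b i) * a2 = 0.
Proof.
move=> /flux_expsum2 FE.
pose q1 := - (s i * xi1 + 2 * b i) / 2 * a1; pose q2 := - (s i * xi2 + 2 * b i) / 2 * a2.
suff q0 : q1 + q2 = 0.
  by rewrite -[RHS](mulr0 (- 2)) -q0 /q1 /q2; field.
have lim : flux i x @[x --> 0^'+] --> q1 + q2.
  apply: cvg_trans (@expsum_cvg0 R xi1 xi2 q1 q2).
  by apply: near_eq_cvg; near=> x; rewrite FE.
by apply: cvg_unique lim (flux_cvg0 i).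
Unshelve. all: by end_near. Qed.

(** The flux vanishes at 0 and at infinity, so integrating its derivative
    [e_i W_i - e_j W_j] balances the switching between environments:
    [e_i m_i = e_j m_j] for the masses [m_i]. *)
Lemma mass_balance (a1 a2 : 'I_2 -> R) :
  (forall i x, 0 < x -> W i x = a1 i * expR (- xi1 * x) + a2 i * expR (- xi2 * x)) ->
  forall i, a1 i / xi1 + a2 i / xi2 = eta (other i) / (eta env1 + eta env2).
Proof.
move=> WE i; pose m k := a1 k / xi1 + a2 k / xi2.
have balance : eta i * m i = eta (other i) * m (other i).
  have FE := flux_expsum2 (WE i).
  pose j := other i.
  (* [m1] and [m2] are the coefficients of minus an antiderivative of
     [e_i W_i - e_j W_j]; adding it to the flux gives a constant. *)
  pose m1 := eta i * (a1 i / xi1) - eta j * (a1 j / xi1).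
  pose m2 := eta i * (a2 i / xi2) - eta j * (a2 j / xi2).
  have [|c cE] := @derive0_pos_cst R
      (fun x => flux i x + (m1 *: expR (- xi1 * x) + m2 *: expR (- xi2 * x))).
    move=> x x0; have h0 := is_derive_flux i x0.
    have h1 := is_derive_expRM (- xi1) x; have h2 := is_derive_expRM (- xi2) x.
    apply: is_derive_eq; rewrite /GRing.scale/= !WE// /m1 /m2 /j.
    by field; rewrite !lt0r_neq0.
  have := @expsum_cst_eq0 R xi1 xi2 (- (s i * xi1 + 2 * b i) / 2 * a1 i + m1)
    (- (s i * xi2 + 2 * b i) / 2 * a2 i + m2) c xi1_gt0 xi2_gt0.
  have := reflecting_coef (WE i); rewrite /m /m1 /m2 -/j => refl0 cst0.
  apply/eqP; rewrite -subr_eq0; apply/eqP.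
  rewrite -[RHS](subr0 0) -{1}cst0.
    by rewrite -[in RHS](mul0r (- 2^-1)) -refl0; field; rewrite !lt0r_neq0.
  by move=> x x0; rewrite -(cE _ x0) FE// /m1 /m2 /GRing.scale/=; ring.
have total : m i + m (other i) = 1.
  have -> : m i + m (other i) = m env1 + m env2.
    by case: (env_cases i) => ->; rewrite ?other1 ?other2// addrC.
  have SE x : 0 < x -> W env1 x + W env2 x =
      (a1 env1 + a1 env2) * expR (- xi1 * x) + (a2 env1 + a2 env2) * expR (- xi2 * x).
    by move=> x0; rewrite !WE//; ring.
  have := integral_expsum xi1_gt0 xi2_gt0 SE; rewrite (steady_total hW).
  by move=> [->]; rewrite /m; field; rewrite !lt0r_neq0.
have sumE : eta env1 + eta env2 = eta i + eta (other i).
  by case: (env_cases i) => ->; rewrite ?other1 ?other2// addrC.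
rewrite -/(m i) sumE; apply: canRL (mulfK _) _; first by rewrite gt_eqF// addr_gt0.
by rewrite mulrDr [m i * _]mulrC balance -[RHS]mulr1 -total; ring.
Qed.

Lemma steady_density_formula i x : 0 < x ->
  let A := steady_weight lambda mu omega eta xi1 xi2 xi3 i in
  W i x = eta (other i) / (eta env1 + eta env2) *
    (A * exponential_pdf xi1 x + (1 - A) * exponential_pdf xi2 x).
Proof.
move=> x0 A.
have [a1 /choice[a2 WE]] := choice W_expsum2.
have mass := mass_balance WE i.
have refl0 := reflecting_coef (WE i).
have [v1 _ v3] := steady_vieta i.
have d0 := steady_denom_neq0 i.
set m := eta _ / _ in mass *.
have sn0 : s i != 0 by rewrite lt0r_neq0.
have z1 := lt0r_neq0 xi1_gt0; have z2 := lt0r_neq0 xi2_gt0.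
have z3 : xi3 != 0 by rewrite lt_eqF.
have z12 : xi1 - xi2 != 0 by rewrite subr_eq0.
pose D := s (other i) * xi3 + 2 * b (other i).
pose N := s (other i) * (xi1 + xi3) + 2 * b (other i).
have dE : steady_denom lambda mu omega xi3 i = D.
  by rewrite /D /steady_denom /drift; ring.
rewrite dE in d0.
have AE : A = - xi2 * N / ((xi1 - xi2) * D).
  rewrite /A /steady_weight dE (stability_envE i).
  have -> : s (other i) * (xi1 + xi3) - 2 * (mu (other i) - lambda (other i)) = N.
    by rewrite /N /drift; ring.
  have -> : s env1 * s env2 = s i * s (other i).
    by case: (env_cases i) => ->; rewrite ?other1 ?other2// mulrC.
  have -> : 4 * - (eta i * b (other i) + eta (other i) * b i) =
    - (s i * s (other i) * (xi1 * xi2 * xi3)) by rewrite v3; ring.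
  by field; rewrite !omega_neq0 z1 z3 z12 d0.
have a1E : a1 i = m * A * xi1.
  have a2E : a2 i = xi2 * (m - a1 i / xi1) by rewrite -mass; field; rewrite z1.
  (* The sum of the roots turns the quantities of environment [i] that the
     reflecting condition contains into those of the other environment. *)
  have sD : s i * D = - (s (other i) * (s i * (xi1 + xi2) + 2 * b i)).
    by apply/eqP; rewrite -subr_eq0 /D; apply/eqP; move: v1; lra.
  have sN : s i * N = - (s (other i) * (s i * xi2 + 2 * b i)).
    by apply/eqP; rewrite -subr_eq0 /N; apply/eqP; move: v1; lra.
  (* The reflecting condition with [a2 i] eliminated through the mass. *)
  have key : a1 i * ((xi1 - xi2) * D) = - xi1 * xi2 * m * N.
    apply: (mulfI sn0).
    transitivity (a1 i * (xi1 - xi2) * (s i * D)); first by ring.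
    transitivity (- xi1 * xi2 * m * (s i * N)); last by ring.
    rewrite sD sN; apply/eqP; rewrite -subr_eq0; apply/eqP.
    rewrite -[RHS](mulr0 (- (xi1 * s (other i)))) -refl0 a2E.
    by field; rewrite z1.
  rewrite AE; apply: (mulIf (mulf_neq0 z12 d0)); rewrite key.
  by field; rewrite z12 d0.
have a2E : a2 i = m * (1 - A) * xi2.
  have -> : a2 i = xi2 * (m - a1 i / xi1) by rewrite -mass; field; rewrite z1.
  by rewrite a1E; field.
by rewrite WE// a1E a2E !exponential_pdfE ?ltW//; ring.
Qed.

End Stationary.

(** * The steady-state law *)

Theorem proposition6 (R : realType) (d : measure_display) (T : measurableType d)
    (P : probability T R) (lambda mu omega eta : 'I_2 -> R) (p y : R)
    (X : R -> {RV P >-> R}) (E : R -> T -> 'I_2)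
    (f : 'I_2 -> R -> R -> R) (W : 'I_2 -> R -> R)
    (hlambda : forall i, 0 < lambda i) (hmu : forall i, 0 < mu i)
    (homega : forall i, 0 < omega i ^+ 2)
    (hp : 0 <= p <= 1) (hy : 0 <= y)
    (hX : alternating_wiener lambda mu omega eta p y X E)
    (hf : transient_densities lambda mu omega eta p y X E f)
    (hW : steady_state_densities lambda mu omega eta f W)
    (heta : forall i, 0 < eta i)
    (hstable : 0 < eta env1 * (mu env2 - lambda env2)
                   + eta env2 * (mu env1 - lambda env1)) :
  (exists xi1 xi2 xi3 : R, steady_roots lambda mu omega eta xi1 xi2 xi3) /\
  (forall xi1 xi2 xi3 : R, steady_roots lambda mu omega eta xi1 xi2 xi3 ->
    forall i : 'I_2,
      steady_denom lambda mu omega xi3 i != 0 /\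
      forall x : R, 0 < x ->
        let A := steady_weight lambda mu omega eta xi1 xi2 xi3 i in
        W i x = eta (other i) / (eta env1 + eta env2) *
          (A * exponential_pdf xi1 x + (1 - A) * exponential_pdf xi2 x)).
Proof.
split; first exact: steady_roots_exist.
move=> xi1 xi2 xi3 roots i; split; first exact: (steady_denom_neq0 homega heta hstable roots).
move=> x x0; apply: (steady_density_formula homega heta hW _ hstable roots) => //.
exact: (steady_density_ge0 hX hf hW).
Qed.
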